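(* Suppose there exists an $(n,k)$-fingerprinting code with security $\xi$. Let $C$ be a concept class with at least two distinct concepts. Let $\alpha\le 1/3$, $\beta,\epsilon>0$, and $\delta<\frac{1-\xi-\beta}{n}-e^\epsilon\xi$. Then every (possibly improper) agnostic $(\alpha,\beta)$-accurate and $(\epsilon,\delta)$-differentially private empirical $k$-learner for $C$ requires sample complexity greater than $n$.
   Context: Fingerprinting code: an $(n,k)$-fingerprinting code is a pair of randomized algorithms $(\mathrm{Gen},\mathrm{Trace})$ (possibly sharing hidden state) where $\mathrm{Gen}$ outputs a codebook $W\in\{0,1\}^{n\times k}$ whose row $w_i$ is the codeword of user $i$, and $\mathrm{Trace}$ takes a word $w'\in\{0,1\}^k$ and outputs some $i\in[n]$ or $\bot$. For $T\subseteq[n]$ let $W_T=\{w_i:i\in T\}$ and $F(W_T)=\{w'\in\{0,1\}^k:\forall j\,\exists i\in T,\ w_{ij}=w'_j\}$. The code has security $\xi\in(0,1]$ if for every randomized adversary $\mathcal A_{FP}$ and every $T\subseteq[n]$, with $w'\leftarrow\mathcal A_{FP}(W_T)$: $\Pr[w'\in F(W_T)\wedge\mathrm{Trace}(w')=\bot]\le\xi$ and $\Pr[\mathrm{Trace}(w')\in[n]\setminus T]\le\xi$. Concepts are functions $X\to\{0,1\}$. For a labeled sample $S'=((x_i,y_i))_{i=1}^n$, $\mathrm{error}_{S'}(h)=\frac1n|\{i:h(x_i)\neq y_i\}|$. An algorithm $\mathcal A$ mapping $k$-labeled databases in $(X\times\{0,1\}^k)^n$ to $k$ hypotheses $(h_1,\dots,h_k)$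 is an agnostic $(\alpha,\beta)$-accurate empirical $k$-learner for $C$ with sample complexity $n$ if for every $S=((x_i,y_{1,i},\dots,y_{k,i}))_{i=1}^n$, $\Pr[\max_j(\mathrm{error}_{S|_j}(h_j)-\min_{c\in C}\mathrm{error}_{S|_j}(c))>\alpha]\le\beta$ over its coins, where $S|_j=((x_i,y_{j,i}))_i$. Two databases of the same size are neighboring if they differ in one entry; $(\epsilon,\delta)$-differential privacy means $\Pr[\mathcal A(S)\in T]\le e^\epsilon\Pr[\mathcal A(S')\in T]+\delta$ for all neighboring $S,S'$ and output sets $T$. *)

(* Defs.v *)
From HB Require Import structures.
From mathcomp Require Import all_boot all_order all_algebra.
From mathcomp Require Import all_classical all_reals all_analysis.

Set Implicit Arguments.
Unset Strict Implicit.
Unset Printing Implicit Defensive.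

Import Order.TTheory GRing.Theory Num.Theory.
Import numFieldNormedType.Exports.

Local Open Scope classical_set_scope.
Local Open Scope ring_scope.

Record fdist (R : realType) (T : finType) := FDist {
  fdist_mass :> T -> R;
  fdist_ge0 : forall x, 0 <= fdist_mass x;
  fdist_sum1 : \sum_(x : T) fdist_mass x = 1 }.

(* Gen draws the hidden state shared with Trace; the codebook is part of (a
   function of) that state. Given the state, Trace may toss further coins;
   [None] stands for the failure symbol. *)
Record fingerprinting_code (R : realType) (n k : nat) := FingerprintingCode {
  fp_display : measure_display;
  fp_state : measurableType fp_display;
  fp_gen : probability fp_state R;
  fp_codebook : fp_state -> 'M[bool]_(n, k);
  fp_trace : fp_state -> 'rV[bool]_k -> fdist R (option 'I_n);
  measurable_fp_codebook :
    forall W, measurable [set s | fp_codebook s = W];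
  measurable_fp_trace :
    forall w o, measurable_fun setT (fun s => fp_trace s w o) }.

Arguments fp_codebook {R n k} f _.
Arguments fp_trace {R n k} f _ _.

(* The codewords of the users in T, listed in increasing order of index. *)
Definition codewords n k (W : 'M[bool]_(n, k)) (T : {set 'I_n}) :
    'M[bool]_(#|T|, k) :=
  rowsub enum_val W.

Definition feasible m k (V : 'M[bool]_(m, k)) : pred 'rV[bool]_k :=
  fun w => [forall j, exists i, V i j == w 0 j].

Section Security.
Context (R : realType) (n k : nat) (code : fingerprinting_code R n k).

Definition adversary (T : {set 'I_n}) :=
  'M[bool]_(#|T|, k) -> fdist R 'rV[bool]_k.

Definition pr_untraced (T : {set 'I_n}) (adv : adversary T) : \bar R :=
  \int[fp_gen code]_s
    let V := codewords (fp_codebook code s) T in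
    (\sum_(w | feasible V w) adv V w * fp_trace code s w None)%:E.

Definition pr_false_accusation (T : {set 'I_n}) (adv : adversary T) : \bar R :=
  \int[fp_gen code]_s
    let V := codewords (fp_codebook code s) T in
    (\sum_w \sum_(i | i \notin T) adv V w * fp_trace code s w (Some i))%:E.

Definition fp_security (xi : R) : Prop :=
  0 < xi <= 1 /\
  forall (T : {set 'I_n}) (adv : adversary T),
    (pr_untraced adv <= xi%:E)%E /\ (pr_false_accusation adv <= xi%:E)%E.

End Security.

Definition labeled_database (X : Type) (k m : nat) :=
  m.-tuple (X * 'rV[bool]_k).

Definition column X k m (S : labeled_database X k m) (j : 'I_k) :
    m.-tuple (X * bool) :=
  map_tuple (fun z : X * 'rV[bool]_k => (z.1, z.2 0 j)) S.

(* Meaningful for m > 0 only. *)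
Definition sample_error (R : realType) X m (S : m.-tuple (X * bool))
    (h : X -> bool) : R :=
  #|[pred i : 'I_m | h (tnth S i).1 != (tnth S i).2]|%:R / m%:R.

(* The errors over a fixed S take at most m + 1 values, so for a nonempty C
   this infimum is a minimum. *)
Definition min_error (R : realType) X (C : set (X -> bool)) m
    (S : m.-tuple (X * bool)) : R :=
  inf [set sample_error R S c | c in C].

(* k-tuples of arbitrary hypotheses X -> bool, with the product sigma-algebra,
   i.e. the least one for which every prediction h_j(x) is a random variable.
   It makes the accuracy event measurable. Asking for privacy on its events only
   is the weakest form of privacy: an algorithm that is private for a finer
   sigma-algebra (such as all subsets, for a discrete algorithm) is private for
   this one. *)
Definition prediction_events (X : Type) (k : nat) :
    set (set ('I_k -> X -> bool)) :=
  [set E | exists j x b, E = [set h | h j x = b]].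

Definition hypotheses (X : Type) (k : nat) :=
  g_sigma_algebraType (@prediction_events X k).

Definition learner (R : realType) X (k m : nat) :=
  labeled_database X k m -> probability (hypotheses X k) R.

Definition max_excess_error (R : realType) X (C : set (X -> bool)) k m
    (S : labeled_database X k m) (h : 'I_k -> X -> bool) : \bar R :=
  \big[maxe/-oo%E]_(j < k)
    (sample_error R (column S j) (h j) - min_error R C (column S j))%:E.

Definition agnostic_accurate_empirical (R : realType) X (C : set (X -> bool))
    k m (alpha beta : R) (A : learner R X k m) : Prop :=
  forall S : labeled_database X k m,
    (A S [set h | (alpha%:E < max_excess_error R C S h)%E] <= beta%:E)%E.

Definition neighboring T m (S S' : m.-tuple T) : Prop :=
  exists2 i, tnth S i <> tnth S' i & forall j, j != i -> tnth S j = tnth S' j.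

Definition differentially_private (R : realType) X k m (epsilon delta : R)
    (A : learner R X k m) : Prop :=
  forall S S' : labeled_database X k m, neighboring S S' ->
  forall E : set (hypotheses X k), measurable E ->
    (A S E <= (expR epsilon)%:E * A S' E + delta%:E)%E.

(* Main.v *)
(* Two distinct concepts disagree at some point x. If all samples sit at x and
   are labelled by codewords, an accurate learner must, with probability at
   least 1 - beta, output hypotheses whose predictions (h_1(x), ..., h_k(x))
   form a feasible word: on a unanimous column a wrong prediction has error 1
   while the best concept has error 0. So these predictions serve as a pirate
   word, and Trace accuses someone with probability at least 1 - beta - xi. By
   privacy, user i is accused about as often when the codeword of i is withheld
   from the learner, and then security bounds this probability by xi. Hence
   1 <= beta + xi + n (e^epsilon xi + delta), against the bound on delta.
   When the sample size m is below n the learner just ignores the last n - m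
   codewords. *)
Require Import Defs.
From mathcomp Require Import all_boot all_order all_algebra.
From mathcomp Require Import all_classical all_reals all_analysis measurable_realfun.
From mathcomp Require Import lra.
Import Order.TTheory GRing.Theory Num.Theory.
Local Open Scope classical_set_scope.
Local Open Scope ring_scope.

Set Implicit Arguments.
Unset Strict Implicit.

(** * Laws of finite-valued random variables *)

Section FiniteValued.
Context {d : measure_display} {S : measurableType d} {T : finType}.
Context (f : S -> T) (mf : forall t, measurable [set s | f s = t]).

Lemma measurable_finite_valued (P : set T) : measurable [set s | P (f s)].
Proof.
have -> : [set s | P (f s)] = \bigcup_(t in P) [set s | f s = t].
  by apply/seteqP; split=> [s Ps|s [t Pt /= ft]]; [exists (f s)|rewrite ft].
by apply: fin_bigcup_measurable => //; exact: finite_finset.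
Qed.

Lemma measurable_fun_finite_valued {R : realType} (F : T -> R) :
  measurable_fun setT (fun s => F (f s)).
Proof. by move=> _ Y _; rewrite setTI; exact: (measurable_finite_valued (F @^-1` Y)). Qed.

Context {R : realType} (P : probability S R).

Lemma finite_law_sum (Q : pred T) :
  \sum_(t | Q t) fine (P [set s | f s = t]) = fine (P [set s | Q (f s)]).
Proof.
have -> : [set s | Q (f s)] = \bigcup_(t in [set` Q]) [set s | f s = t].
  by apply/seteqP; split=> [s Qs|s [t Qt /= ft]]; [exists (f s)|rewrite ft].
rewrite measure_fin_bigcup//; last by move=> t u _ _ [s /= [<- <-]].
rewrite -(bigfs _ (r := index_enum T)) ?index_enum_uniq//.
  by rewrite sum_fine// => t _; exact: fin_num_measure.
by move=> t _; rewrite mem_index_enum.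
Qed.

Lemma finite_law_ge0 (t : T) : 0 <= fine (P [set s | f s = t]).
Proof. exact: fine_ge0. Qed.

Lemma finite_law_sum1 : \sum_t fine (P [set s | f s = t]) = 1.
Proof.
rewrite finite_law_sum (_ : [set s | predT (f s)] = setT) ?probability_setT//.
by apply/seteqP; split.
Qed.

(** The pushforward of [P] along [f], as a real-valued mass function. *)
Definition finite_law : fdist R T := FDist finite_law_ge0 finite_law_sum1.

End FiniteValued.

Lemma fdist_le1 {R : realType} {T : finType} (p : fdist R T) t : p t <= 1.
Proof.
by rewrite -(fdist_sum1 p) (bigD1 t)//= lerDl sumr_ge0// => u _; exact: fdist_ge0.
Qed.

(* Only the outcomes where p exceeds c * q contribute positively, and f <= 1
   there: approximate privacy on events passes to weighted averages. *)
Lemma fdist_weighted_le {R : realType} {T : finType} (p q : fdist R T) (f : T -> R) c e :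
    (forall Q : pred T, \sum_(t | Q t) p t <= c * (\sum_(t | Q t) q t) + e) ->
    (forall t, 0 <= f t <= 1) ->
  \sum_t p t * f t <= c * (\sum_t q t * f t) + e.
Proof.
move=> pq f01; rewrite -lerBlDl mulr_sumr -sumrB.
pose Q := [pred t | 0 <= p t - c * q t].
apply: (@le_trans _ _ (\sum_(t | Q t) (p t - c * q t))); last first.
  by rewrite sumrB -mulr_sumr lerBlDl pq.
rewrite big_mkcond/= [leRHS]big_mkcond/=; apply: ler_sum => t _.
have /andP[f0 f1] := f01 t.
rewrite mulrA -mulrBl; case: ifPn => [D0|]; first by rewrite ler_piMr.
by rewrite -ltNge => /ltW D0; rewrite mulr_le0_ge0.
Qed.

(** * Databases whose samples all sit at one point *)

Section OnePointDatabase.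
Context {R : realType} {X : Type} {k : nat}.

Definition prediction (x : X) (h : 'I_k -> X -> bool) : 'rV[bool]_k :=
  \row_j h j x.

(** The event is a finite intersection of generators from [prediction_events]. *)
Lemma measurable_prediction x (w : 'rV[bool]_k) :
  measurable ([set h | prediction x h = w] : set (hypotheses X k)).
Proof.
have -> : [set h | prediction x h = w] =
    \bigcap_(j in [set: 'I_k]) [set h : hypotheses X k | h j x = w 0 j].
  apply/seteqP; split=> [h /= <- j _ /=|h hw]; first by rewrite mxE.
  by apply/rowP => j; rewrite mxE; exact: hw.
apply: fin_bigcap_measurable => [|j _]; first exact: finite_finset.
by apply: sub_gen_smallest; exists j, x, (w 0 j).
Qed.

Definition one_point_database (x : X) m (W : 'I_m -> 'rV[bool]_k) :
  labeled_database X k m := [tuple (x, W a) | a < m].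

Lemma sample_error_one_point x m (W : 'I_m -> 'rV[bool]_k) j (c : X -> bool) :
  sample_error R (column (one_point_database x W) j) c =
  #|[pred a | c x != W a 0 j]|%:R / m%:R.
Proof.
rewrite /sample_error; congr (_%:R / _); apply: eq_card => a.
by rewrite !inE tnth_map tnth_mktuple.
Qed.

(** Labels are Boolean, so column [j] is constantly [~~ h j x]: [h j] errs on every sample, while a
    concept with that value at [x] errs on none. *)
Lemma max_excess_error_infeasible (C : set (X -> bool)) x m
    (W : 'I_m -> 'rV[bool]_k) j h :
    (0 < m)%N -> (exists c0, C c0 /\ c0 x = false) -> (exists c1, C c1 /\ c1 x = true) ->
    (forall a, W a 0 j != h j x) ->
  (1 <= max_excess_error R C (one_point_database x W) h)%E.
Proof.
move=> m0 [c0 [Cc0 c0x]] [c1 [Cc1 c1x]] Wh.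
apply: le_trans (le_bigmax _ _ j); rewrite lee_fin.
set S := column _ j.
have err b c : (forall a, W a 0 j = b) -> sample_error R S c = (c x != b)%:R.
  move=> Wb; rewrite sample_error_one_point (eq_card (B := [pred _ | c x != b])).
    case: (_ != b); last by rewrite card0 mul0r.
    by rewrite card_ord divff// pnatr_eq0 -lt0n.
  by move=> a; rewrite !inE Wb.
have Wb a : W a 0 j = ~~ h j x by move: (Wh a); case: (W a 0 j); case: (h j x).
have [c [Cc cx]] : exists c, C c /\ c x = ~~ h j x.
  by case: (h j x); [exists c0|exists c1].
have min0 : min_error R C S <= 0.
  apply: ge_inf; last by exists c => //; rewrite (err _ _ Wb) cx eqxx.
  by exists 0 => _ [c' _ <-]; rewrite divr_ge0.
by rewrite (err _ _ Wb); move: min0; case: (h j x) => /=; lra.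
Qed.

End OnePointDatabase.

(** * The distribution of a learner's predictions at [x] *)

Section LearnerLaw.
Context {R : realType} {X : Type} {k m : nat} (A : learner R X k m) (x : X).

Definition learner_law (W : 'I_m -> 'rV[bool]_k) : fdist R 'rV[bool]_k :=
  finite_law (measurable_prediction x) (A (one_point_database x W)).

(** A word in [Q] misses a whole column, so its excess error is at least 1, above [alpha]: the event
    lies inside the failure event of the accuracy guarantee. *)
Lemma learner_law_infeasible (C : set (X -> bool)) alpha beta
    (W : 'I_m -> 'rV[bool]_k) (Q : pred 'rV[bool]_k) :
    (0 < m)%N -> alpha < 1 ->
    (exists c0, C c0 /\ c0 x = false) -> (exists c1, C c1 /\ c1 x = true) ->
    agnostic_accurate_empirical C alpha beta A ->
    (forall w, Q w -> exists j, forall a, W a 0 j != w 0 j) ->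
  \sum_(w | Q w) learner_law W w <= beta.
Proof.
move=> m0 alpha1 C0 C1 acc QW; set S := one_point_database x W.
rewrite (finite_law_sum (measurable_prediction x)) -lee_fin.
rewrite fineK ?fin_num_measure//; last first.
  exact: (measurable_finite_valued (measurable_prediction x) [set w | Q w]).
apply: le_trans (acc S); apply: le_measure; rewrite ?inE.
- exact: (measurable_finite_valued (measurable_prediction x) [set w | Q w]).
(* On a one-point database the excess error depends on [h] only through its predictions at [x];
   constant hypotheses with the same predictions make the event a preimage under [prediction x]. *)
- have -> : [set h | (alpha%:E < max_excess_error R C S h)%E] =
      [set h | (alpha%:E < max_excess_error R C S
        (fun j _ => prediction x h ord0 j))%E].
    apply/funext => h /=; rewrite /max_excess_error.
    under eq_bigr do rewrite sample_error_one_point.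
    under [in RHS]eq_bigr do rewrite sample_error_one_point mxE.
    by [].
  exact: (measurable_finite_valued (measurable_prediction x)
    [set w | (alpha%:E < max_excess_error R C S (fun j _ => w ord0 j))%E]).
- move=> h /= /QW[j Wj].
  apply: (@lt_le_trans _ _ 1%E); first by rewrite lte_fin.
  apply: (max_excess_error_infeasible (j := j)) => // a.
  by have := Wj a; rewrite mxE.
Qed.

Context {epsilon delta : R} (epsilon_ge0 : 0 <= epsilon)
  (private : differentially_private epsilon delta A).

(** Privacy on the empty event reads [0 <= delta]; the positivity of [m] and [k] provides a pair of
    neighbors to apply it to. *)
Lemma private_delta_ge0 : (0 < m)%N -> (0 < k)%N -> 0 <= delta.
Proof.
move=> m0 k0; pose b (v : bool) : 'I_m -> 'rV[bool]_k :=
  fun a => if a == Ordinal m0 then const_mx v else const_mx false.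
have nb : neighboring (one_point_database x (b true)) (one_point_database x (b false)).
  exists (Ordinal m0) => [|a /negPf a0]; rewrite !tnth_mktuple /b ?a0// eqxx.
  by case => /matrixP/(_ 0 (Ordinal k0)); rewrite !mxE.
have := private nb (@measurable0 _ _).
by rewrite !measure0 mule0 add0e lee_fin.
Qed.

(** [P] marks at most one sample and may be empty, which happens when the withheld user is not among
    the first [m]. *)
Lemma private_learner_law (W W' : 'I_m -> 'rV[bool]_k) (P : pred 'I_m) :
    (0 < m)%N -> (0 < k)%N ->
    (forall a b, P a -> P b -> a = b) ->
    (forall a, ~~ P a -> W a = W' a) ->
  forall Q : pred 'rV[bool]_k,
  \sum_(w | Q w) learner_law W w <=
    expR epsilon * (\sum_(w | Q w) learner_law W' w) + delta.
Proof.
move=> m0 k0 P1 WW' Q; have d0 := private_delta_ge0 m0 k0.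
(* [neighboring] demands a genuine difference, so [W = W'] is treated apart, using
   [expR epsilon >= 1] and [delta >= 0]. *)
have [[a Wa]|noa] := pselect (exists a, W a <> W' a); last first.
  have -> : W = W'.
    by apply/funext => a; apply: contrapT => Wa; apply: noa; exists a.
  rewrite -[leLHS]addr0 lerD// ler_peMl ?sumr_ge0//.
    by move=> w _; exact: fdist_ge0.
  by rewrite -expR0 ler_expR.
have Pa : P a by apply: contrapT => /negP/WW'.
rewrite !(finite_law_sum (measurable_prediction x)) -lee_fin EFinD EFinM.
have mQ := measurable_finite_valued (measurable_prediction x) [set w | Q w].
rewrite !fineK ?fin_num_measure//; apply: private => //.
exists a => [|b]; rewrite !tnth_mktuple; first by case.
by move=> ba; rewrite WW'//; apply: contra ba => Pb; apply/eqP; exact: P1.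
Qed.

End LearnerLaw.

(** Puts the coalition's codewords back at their users' rows and fills the other rows with [false],
    so that a coalition can run a procedure expecting a full codebook. *)
Definition unmask n k (T : {set 'I_n}) (V : 'M[bool]_(#|T|, k)) : 'M[bool]_(n, k) :=
  \matrix_(i, j) [exists r, (enum_val r == i) && V r j].

Lemma unmask_codewords n k (W : 'M[bool]_(n, k)) (T : {set 'I_n}) i j :
  unmask (codewords W T) i j = (i \in T) && W i j.
Proof.
rewrite mxE; apply/existsP/andP => [[r]|[iT Wij]].
  by rewrite mxE => /andP[/eqP <-]; split=> //; exact: enum_valP.
by exists (enum_rank_in iT i); rewrite mxE enum_rankK_in// eqxx.
Qed.

Lemma infeasible_codewords n k (W : 'M[bool]_(n, k)) (w : 'rV[bool]_k) :
  ~~ feasible (codewords W [set: 'I_n]%SET)  w -> exists j, forall i, W i j != w 0 j.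
Proof.
rewrite negb_forall => /existsP[j]; rewrite negb_exists => /forallP jw.
exists j => i; have := jw (enum_rank_in (finset.in_setT i) i).
by rewrite mxE enum_rankK_in// inE.
Qed.

(** * Tracing a pirate word drawn from a stable law [D] *)

Section Tracing.
Context {R : realType} {n k : nat} (code : fingerprinting_code R n k) (xi : R).

(** The state enters [F] and [Q] only through the codebook, which takes finitely many values. *)
Lemma measurable_codebook_trace (F : 'M[bool]_(n, k) -> 'rV[bool]_k -> R)
    (Q : 'M[bool]_(n, k) -> pred 'rV[bool]_k) o :
  measurable_fun setT (fun s =>
    (\sum_(w | Q (fp_codebook code s) w)
      F (fp_codebook code s) w * fp_trace code s w o)%:E).
Proof.
apply/measurable_EFinP.
under eq_fun do rewrite big_mkcond/=.
apply: measurable_sum => w.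
rewrite (_ : (fun s => _) = (fun s => (if Q (fp_codebook code s) w then
  F (fp_codebook code s) w else 0) * fp_trace code s w o)); last first.
  by apply/funext => s; case: ifP => // _; rewrite mul0r.
apply: measurable_funM; last exact: measurable_fp_trace.
exact: (measurable_fun_finite_valued (@measurable_fp_codebook _ _ _ code)
  (fun W => if Q W w then F W w else 0)).
Qed.

Context (D : 'M[bool]_(n, k) -> fdist R 'rV[bool]_k).

(** At a fixed state, the pirate word is infeasible, or feasible and untraced, or leads to the
    accusation of some user. *)
Lemma trace_total (W : 'M[bool]_(n, k)) s beta :
    \sum_(w | ~~ feasible (codewords W [set: 'I_n]%SET) w) D W w <= beta ->
  1 <= beta
    + \sum_(w | feasible (codewords W [set: 'I_n]%SET) w) D W w * fp_trace code s w None
    + \sum_i \sum_w D W w * fp_trace code s w (Some i).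
Proof.
move=> infeas; rewrite exchange_big/= -(fdist_sum1 (D W)).
have split_option w : D W w = D W w * fp_trace code s w None +
    \sum_i D W w * fp_trace code s w (Some i).
  rewrite -mulr_sumr -mulrDr -[X in D W w * X](_ : 1 = _) ?mulr1//.
  rewrite -(fdist_sum1 (fp_trace code s w)) (bigD1 None)//=; congr (_ + _).
  rewrite (reindex_omap Some id) => [|[]//].
  by apply: eq_bigl => i; rewrite eqxx.
rewrite (eq_bigr _ (fun w _ => split_option w)) big_split/= lerD2r.
rewrite (bigID (feasible (codewords W [set: 'I_n]%SET)))/= addrC lerD2r.
apply: le_trans infeas; apply: ler_sum => w _.
by rewrite ler_piMr ?fdist_ge0 ?fdist_le1.
Qed.

(** Accusing [i] is compared with accusing [i] after blanking row [i]; the latter is a false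
    accusation by the coalition of all the others, hence at most [xi] on average over the state. *)
Lemma fp_security_stable_bound (beta c e : R) :
    fp_security code xi -> 0 <= beta -> 0 <= c -> 0 <= e ->
    (forall W, \sum_(w | ~~ feasible (codewords W [set: 'I_n]%SET) w) D W w <= beta) ->
    (forall W W' i, (forall i', i' != i -> row i' W = row i' W') ->
      forall Q : pred 'rV[bool]_k,
      \sum_(w | Q w) D W w <= c * (\sum_(w | Q w) D W' w) + e) ->
  1 <= beta + xi + n%:R * (c * xi + e).
Proof.
move=> [_ secure] beta0 c0 e0 infeas stable.
pose adv T : adversary R k T := fun V => D (unmask V).
have unmaskT W : unmask (codewords W [set: 'I_n]%SET) = W.
  by apply/matrixP => i j; rewrite unmask_codewords inE.
pose u s := \sum_(w | feasible (codewords (fp_codebook code s) [set: 'I_n]%SET) w)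
  D (fp_codebook code s) w * fp_trace code s w None.
pose v i s := \sum_w D (unmask (codewords (fp_codebook code s) (~: [set i])%SET)) w
  * fp_trace code s w (Some i).
pose U s := (u s)%:E; pose V i s := (v i s)%:E.
have mU : measurable_fun setT U.
  exact: (measurable_codebook_trace (fun W w => D W w)
    (fun W => feasible (codewords W [set: 'I_n]%SET))).
have mV i : measurable_fun setT (V i).
  exact: (measurable_codebook_trace
    (fun W w => D (unmask (codewords W (~: [set i])%SET)) w)
    (fun=> predT)).
have U0 s : (0 <= U s)%E.
  by rewrite lee_fin sumr_ge0// => w _; rewrite mulr_ge0 ?fdist_ge0.
have V0 i s : (0 <= V i s)%E.
  by rewrite lee_fin sumr_ge0// => w _; rewrite mulr_ge0 ?fdist_ge0.
have intU : (\int[fp_gen code]_s U s <= xi%:E)%E.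
  suff -> : (\int[fp_gen code]_s U s = pr_untraced code (adv [set: 'I_n]%SET))%E.
    by have [] := secure _ (adv [set: 'I_n]%SET).
  by apply: eq_integral => s _; rewrite /adv unmaskT.
have intV i : (\int[fp_gen code]_s V i s <= xi%:E)%E.
  suff -> : (\int[fp_gen code]_s V i s =
      pr_false_accusation code (adv (~: [set i])%SET))%E.
    by have [] := secure _ (adv (~: [set i])%SET).
  apply: eq_integral => s _; congr (_%:E).
  apply: eq_bigr => w _; rewrite (big_pred1 i)// => i'.
  by rewrite !inE negbK.
(* With [s] fixed, the tracer is the same for both codebooks, so its accusation probability can
   serve as the weight in [fdist_weighted_le]. *)
have pointwise s : (1 <= beta%:E + U s + \sum_i (c%:E * V i s + e%:E))%E.
  have -> : (beta%:E + U s + \sum_i (c%:E * V i s + e%:E))%E =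
      (beta + u s + \sum_i (c * v i s + e))%:E by rewrite EFinD sumEFin.
  rewrite lee_fin.
  apply: le_trans (trace_total s (infeas _)) _; apply: lerD => //; first exact: lexx.
  apply: ler_sum => i _; apply: fdist_weighted_le => [|w].
    apply: (stable _ _ i) => i' i'i; apply/rowP => j.
    by rewrite [LHS]mxE [RHS]mxE unmask_codewords !inE i'i.
  by rewrite fdist_ge0 fdist_le1.
have intcst (r : R) : (\int[fp_gen code]_s r%:E = r%:E)%E.
  by rewrite integral_cst// [X in (_ * X)%E]probability_setT mule1.
have mcV i : measurable_fun setT (fun s => c%:E * V i s)%E.
  exact: measurable_funeM.
have mcVe i : measurable_fun setT (fun s => c%:E * V i s + e%:E)%E.
  exact: emeasurable_funD.
have cV0 i s : (0 <= c%:E * V i s)%E by rewrite mule_ge0.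
have cVe0 i s : (0 <= c%:E * V i s + e%:E)%E by rewrite adde_ge0.
have bU0 s : (0 <= beta%:E + U s)%E by rewrite adde_ge0.
have mbU : measurable_fun setT (fun s => beta%:E + U s)%E.
  exact: emeasurable_funD.
have msum : measurable_fun setT (fun s => \sum_i (c%:E * V i s + e%:E))%E.
  exact: emeasurable_sum.
have sum0 s : (0 <= \sum_i (c%:E * V i s + e%:E))%E by rewrite sume_ge0.
(* Averaging over the state turns [U] and each [V i] into quantities bounded by security. *)
have := @ge0_le_integral _ _ _ (fp_gen code) setT measurableT
  (fun=> 1%:E) _ (fun=> fun=> lee01) (measurable_cst _)
  (emeasurable_funD mbU msum) (fun s _ => pointwise s).
rewrite intcst ge0_integralD// ge0_integralD// intcst ge0_integral_sum//.
under eq_bigr do rewrite ge0_integralD// ge0_integralZl_EFin// intcst.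
move=> le1; rewrite -lee_fin; apply: (le_trans le1).
rewrite 2!EFinD; apply: leeD; first exact: leeD.
rewrite (_ : (n%:R * (c * xi + e))%:E = \sum_(i < n) (c * xi + e)%:E)%E; last first.
  by rewrite sumEFin sumr_const card_ord mulr_natl.
by apply: lee_sum => i _; rewrite EFinD EFinM leeD// lee_wpmul2l.
Qed.

End Tracing.

(** * The learner as a pirate: lower bound on the sample size *)

Theorem theorem4p7 (R : realType) (n k : nat) (xi : R)
    (k_gt0 : (0 < k)%N)
    (fp_code : exists code : fingerprinting_code R n k, fp_security code xi)
    (X : Type) (C : set (X -> bool))
    (C_two : exists c c' : X -> bool, C c /\ C c' /\ c <> c')
    (alpha beta epsilon delta : R)
    (alpha_le : alpha <= 1 / 3%:R) (beta_gt0 : 0 < beta)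
    (epsilon_gt0 : 0 < epsilon)
    (delta_lt : delta < (1 - xi - beta) / n%:R - expR epsilon * xi)
    (m : nat) (m_gt0 : (0 < m)%N) (A : learner R X k m) :
  agnostic_accurate_empirical C alpha beta A ->
  differentially_private epsilon delta A ->
  (n < m)%N.
Proof.
move=> acc private; rewrite ltnNge; apply/negP => mn.
have n0 : (0 < n)%N := leq_trans m_gt0 mn.
have [code secure] := fp_code.
have [x [C0 C1]] : exists x, (exists c0, C c0 /\ c0 x = false) /\
    (exists c1, C c1 /\ c1 x = true).
  have [c [c' [Cc [Cc' cc']]]] := C_two.
  have [x cx] : exists x, c x <> c' x.
    apply: contrapT => same; apply: cc'; apply/funext => x.
    by apply: contrapT => cx; apply: same; exists x.
  exists x; case E : (c x) cx; case E' : (c' x) => // _.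
  - by split; [exists c'|exists c].
  - by split; [exists c|exists c'].
pose users (W : 'M[bool]_(n, k)) (a : 'I_m) := row (widen_ord mn a) W.
have epsilon_ge0 := ltW epsilon_gt0.
have delta_ge0 := private_delta_ge0 x private m_gt0 k_gt0.
have : 1 <= beta + xi + n%:R * (expR epsilon * xi + delta).
  apply: (fp_security_stable_bound (D := fun W => learner_law A x (users W))
    secure (ltW beta_gt0) (expR_ge0 _) delta_ge0) => [W|W W' i WW' Q].
    apply: (learner_law_infeasible m_gt0 _ C0 C1 acc); first by lra.
    move=> w /infeasible_codewords[j Wj]; exists j => a.
    by rewrite mxE.
  (* The only sample that can change is the one carrying the codeword of user [i], unique since
     [widen_ord] is injective. *)
  apply: (private_learner_law x epsilon_ge0 private
    (P := fun a => widen_ord mn a == i)) => //.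
  - by move=> a b /eqP <- /eqP/(congr1 val)/= ab; apply: val_inj.
  - by move=> a ai; rewrite /users WW'.
(* Clearing the denominator [n] gives [(delta + expR epsilon * xi) * n < 1 - xi - beta],
   contradicting the bound. *)
move: delta_lt; rewrite ltrBrDr ltr_pdivlMr ?ltr0n//; lra.
Qed.
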